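(* Let $d\ge 2$ be an integer, $n\ge 1$, and let $\alpha_1,\dots,\alpha_n>0$. Then \[ \frac{\sum_{k=1}^n \alpha_k^{1+2/d}}{\sum_{k=1}^n \alpha_k^{2/d}} \le Q_d(\alpha). \] Equality holds identically (for all positive weights) when $d=2$. When $d>2$ and at least two weights are present (i.e. $n\ge 2$), the inequality is strict.
   Context: For positive weights $\alpha=(\alpha_1,\dots,\alpha_n)$ put \[ A=\sum_{k=1}^n \alpha_k,\qquad Q_d(\alpha)=A^{-1/(d-1)}\sum_{k=1}^n \alpha_k^{d/(d-1)}. \] *)

(* Defs.v *)
From mathcomp Require Import all_boot all_order all_algebra.
From mathcomp Require Import reals exp.

Set Implicit Arguments.
Unset Strict Implicit.
Unset Printing Implicit Defensive.

Import Order.TTheory GRing.Theory Num.Theory.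
Local Open Scope ring_scope.

Definition total_weight (R : realType) (n : nat) (alpha : 'I_n -> R) : R :=
  \sum_(k < n) alpha k.

Definition Qd (R : realType) (d n : nat) (alpha : 'I_n -> R) : R :=
  total_weight alpha `^ (- 1 / (d%:R - 1)) *
  \sum_(k < n) alpha k `^ (d%:R / (d%:R - 1)).

(* Main.v *)
Require Import Defs.
From mathcomp Require Import all_boot all_order all_algebra.
From mathcomp Require Import reals exp.
From mathcomp Require Import ring lra.

Import Order.TTheory GRing.Theory Num.Theory.
Local Open Scope ring_scope.

(** Put p = 1/(d-1), q = 2/d and write S(r) for the sum of the alpha_k^r, so
    that A = S(1) and the claim reads S(1+q) / S(q) <= A^(-p) S(1+p).  After
    rescaling to A = 1 all weights are at most 1, which makes powers of the
    weights antitone in the exponent.  As p <= q this gives S(1+q) <= S(1+p),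
    and as q <= 1 it gives S(q) >= S(1) = 1; dividing the two proves the claim.
    The homogeneous forms of these two bounds, valid without rescaling, are
    [sum_powRD_le] and [powR_sum_le].

    For d = 2 one has p = q = 1, and the two sides are literally the same
    quotient S(2) / A.  For d > 2 one has q < 1, and with two or more weights
    each one is strictly smaller than A, so the bound on S(q) is strict
    ([powR_sum_lt]). *)

Lemma powRDgt0 (R : realType) (x r s : R) : 0 < x ->
  x `^ (r + s) = x `^ r * x `^ s.
Proof. by move=> x_gt0; rewrite powRD // lt0r_neq0 ?implybT. Qed.

Lemma powR_mulB1 (R : realType) (x q : R) : 0 < x -> x `^ q = x * x `^ (q - 1).
Proof.
move=> x_gt0; rewrite -{2}(powRr1 (ltW x_gt0)) -powRDgt0 //.
by congr (_ `^ _); ring.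
Qed.

Section PowerSums.
Variables (R : realType) (I : finType) (a : I -> R).
Hypothesis a_gt0 : forall i, 0 < a i.

Let A := \sum_i a i.

Lemma le_term_sum i : a i <= A.
Proof.
by rewrite /A (bigD1 i) //= lerDl; apply: sumr_ge0 => j _; apply: ltW.
Qed.

Lemma lt_term_sum i : (1 < #|I|)%N -> a i < A.
Proof.
move=> I_gt1; rewrite /A (bigD1 i) //= ltrDl.
have [j ji] : exists j, j != i.
  have /card_gt1P[x [y [_ _ xy]]] := I_gt1.
  by case: (eqVneq x i) xy => [-> iy|xi _]; [exists y; rewrite eq_sym|exists x].
rewrite (bigD1 j) //= ltr_wpDr //; apply: sumr_ge0 => k _; exact: ltW.
Qed.

Lemma powR_sumE q : 0 < A -> A `^ q = \sum_i a i * A `^ (q - 1).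
Proof. by move=> A_gt0; rewrite -mulr_suml -/A -powR_mulB1. Qed.

(** The map x |-> x^q is subadditive for q <= 1, because the ratio
    x^q / x = x^(q-1) is antitone: both sides are written as sums of this
    ratio weighted by the a_i, at A on the left and at a_i on the right. *)
Lemma powR_sum_le q : 0 < A -> q <= 1 -> A `^ q <= \sum_i a i `^ q.
Proof.
move=> A_gt0 q_le1; rewrite powR_sumE //; apply: ler_sum => i _.
(* Inverting turns the exponent q - 1 <= 0 into 1 - q >= 0. *)
rewrite (powR_mulB1 _ (a i)) // ler_pM2l //
  -(opprB 1 q) !powRN lef_pV2 ?posrE ?powR_gt0 //.
by rewrite ge0_ler_powR ?nnegrE ?subr_ge0 ?(ltW A_gt0) ?(ltW (a_gt0 i)) //
  le_term_sum.
Qed.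

(** With two or more terms every a_i is strictly below A, so for q < 1 each
    term of the comparison is strict. *)
Lemma powR_sum_lt q : 0 < A -> q < 1 -> (1 < #|I|)%N ->
  A `^ q < \sum_i a i `^ q.
Proof.
move=> A_gt0 q_lt1 I_gt1; rewrite powR_sumE //; apply: ltr_sum.
  have /card_gt0P[i _] := ltnW I_gt1.
  by apply/hasP; exists i; rewrite ?mem_index_enum.
move=> i _.
rewrite (powR_mulB1 _ (a i)) // ltr_pM2l //
  -(opprB 1 q) !powRN ltf_pV2 ?posrE ?powR_gt0 //.
by rewrite gt0_ltr_powR ?nnegrE ?subr_gt0 ?(ltW A_gt0) ?(ltW (a_gt0 i)) //
  lt_term_sum.
Qed.

(** Raising the exponent by q - p >= 0 costs at most a factor A^(q-p), since
    no weight exceeds A. *)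
Lemma sum_powRD_le p q : 0 < A -> p <= q ->
  \sum_i a i `^ (1 + q) <= A `^ (q - p) * \sum_i a i `^ (1 + p).
Proof.
move=> A_gt0 pq; rewrite mulr_sumr; apply: ler_sum => i _.
have -> : 1 + q = (q - p) + (1 + p) by ring.
rewrite powRDgt0 // ler_pM2r ?powR_gt0 //.
by rewrite ge0_ler_powR ?nnegrE ?subr_ge0 ?(ltW A_gt0) ?(ltW (a_gt0 i)) //
  le_term_sum.
Qed.

Lemma sum_powRD_div_le p q : 0 < A -> p <= q ->
  (\sum_i a i `^ (1 + q)) / A `^ q <= A `^ (- p) * \sum_i a i `^ (1 + p).
Proof.
move=> A_gt0 pq; rewrite ler_pdivrMr ?powR_gt0 // mulrAC -powRDgt0 //.
by rewrite [- p + q]addrC sum_powRD_le.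
Qed.

Lemma sum_powR_gt0 r : (0 < #|I|)%N -> 0 < \sum_i a i `^ r.
Proof.
move=> /card_gt0P[i _]; rewrite (bigD1 i) //= ltr_wpDr ?powR_gt0 //.
by apply: sumr_ge0 => j _; exact: powR_ge0.
Qed.

Lemma sum_gt0 : (0 < #|I|)%N -> 0 < A.
Proof.
by move=> /card_gt0P[i _]; apply: lt_le_trans _ (le_term_sum i).
Qed.

Lemma sum_powR_ratio_le p q : (0 < #|I|)%N -> p <= q -> q <= 1 ->
  (\sum_i a i `^ (1 + q)) / (\sum_i a i `^ q)
    <= A `^ (- p) * \sum_i a i `^ (1 + p).
Proof.
move=> I_gt0 pq q_le1; have A_gt0 := sum_gt0 I_gt0.
apply: le_trans _ (sum_powRD_div_le _ _ A_gt0 pq).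
by rewrite ler_pM2l ?lef_pV2 ?posrE ?sum_powR_gt0 ?powR_gt0 ?powR_sum_le.
Qed.

Lemma sum_powR_ratio_lt p q : (1 < #|I|)%N -> p <= q -> q < 1 ->
  (\sum_i a i `^ (1 + q)) / (\sum_i a i `^ q)
    < A `^ (- p) * \sum_i a i `^ (1 + p).
Proof.
move=> I_gt1 pq q_lt1; have I_gt0 := ltnW I_gt1; have A_gt0 := sum_gt0 I_gt0.
apply: lt_le_trans _ (sum_powRD_div_le _ _ A_gt0 pq).
by rewrite ltr_pM2l ?ltf_pV2 ?posrE ?sum_powR_gt0 ?powR_gt0 ?powR_sum_lt.
Qed.

End PowerSums.

Theorem proposition1p3 (R : realType) (d n : nat) (hd : (2 <= d)%N)
    (hn : (1 <= n)%N) (alpha : 'I_n -> R) (halpha : forall k, 0 < alpha k) :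
  [/\ (\sum_(k < n) alpha k `^ (1 + 2 / d%:R)) /
        (\sum_(k < n) alpha k `^ (2 / d%:R)) <= Qd d alpha,
      d = 2%N ->
        (\sum_(k < n) alpha k `^ (1 + 2 / d%:R)) /
          (\sum_(k < n) alpha k `^ (2 / d%:R)) = Qd d alpha
    & (2 < d)%N -> (2 <= n)%N ->
        (\sum_(k < n) alpha k `^ (1 + 2 / d%:R)) /
          (\sum_(k < n) alpha k `^ (2 / d%:R)) < Qd d alpha].
Proof.
have d2 : (2 : R) <= d%:R by rewrite ler_nat.
have d_gt0 : (0 : R) < d%:R by lra.
have d1_gt0 : (0 : R) < d%:R - 1 by lra.
have q_le1 : (2 / d%:R : R) <= 1 by rewrite ler_pdivrMr // mul1r.
have pq : (1 / (d%:R - 1) : R) <= 2 / d%:R.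
  by rewrite ler_pdivrMr // mulrAC ler_pdivlMr //; lra.
(* The exponents of Qd are -p and 1 + p for p = 1/(d-1). *)
have QdE : Qd d alpha = (\sum_k alpha k) `^ (- (1 / (d%:R - 1))) *
    \sum_k alpha k `^ (1 + 1 / (d%:R - 1)).
  rewrite /Qd /total_weight mulNr; congr (_ * _); apply: eq_bigr => k _.
  by congr (_ `^ _); field; rewrite lt0r_neq0.
rewrite QdE; split.
- by apply: sum_powR_ratio_le => //; rewrite card_ord.
- move=> d_eq2.
  have -> : (2 / d%:R : R) = 1 by rewrite d_eq2 divff // pnatr_eq0.
  have -> : (1 / (d%:R - 1) : R) = 1 by rewrite d_eq2; field.
  under [X in _ / X]eq_bigr => k _ do rewrite powRr1 ?ltW //.
  by rewrite powR_inv1 1?mulrC // sumr_ge0 // => k _; exact: ltW.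
- move=> d_gt2 n_gt1; apply: sum_powR_ratio_lt; rewrite ?card_ord //.
  by rewrite ltr_pdivrMr // mul1r ltr_nat.
Qed.
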